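(* Let $h:\mathbb{R}^n\to\mathbb{R}$ be continuously differentiable with relative degree 1 with respect to $\dot x=f(x)+g(x)u$, let $\mathcal{C}=\{x\in\mathbb{R}^n: h(x)\ge 0\}$, and suppose there is $L>0$ with $|h(x)-h(\hat x)|\le L\|x-\hat x\|$ for all $x,\hat x\in\mathbb{R}^n$. Let $x(t)$ and $\hat x(t)$ denote the state of the plant and of its estimation error quantified (EEQ) observer with error bound $M(t)$, so that $\hat x$ satisfies the reconstructed system $$\dot{\hat x}=f(\hat x)+g(\hat x)u+\sum_{i=1}^N\theta_i\varphi_i(t)+\epsilon_\Lambda(t)$$ with unknown constant parameters $\theta_i\in\mathbb{R}^n$. Suppose $\|\epsilon_\Lambda(t)\|\le E$ for a constant $E>0$, and $\|\theta_i\|\le\bar\theta_i$ for known constants $\bar\theta_i>0$, $i=1,\dots,N$. Let $\mu>0$ and $\epsilon>0$ be constants, and define $$h_0(\hat x,t)=h(\hat x)-L\,M(t),\qquad h_\epsilon(\hat x,t)=h_0(\hat x,t)-\epsilon .$$ Suppose the parameter estimates $\hat\theta_i(t)\in\mathbb{R}^n$, $i=1,\dots,N$, are governed by $$\dot{\hat\theta}_i=-\frac{\bar\theta_i^2}{2\epsilon}\,\frac{\partial h_\epsilon}{\partial \hat x}\,\varphi_i-\mu\hat\theta_i .$$ If $\epsilon$ satisfies $$0<\epsilon\le\frac{h_0(\hat x(0),0)}{N+\sum_{i=1}^N\left(\frac{2\|\hat\theta_i(0)\|}{\bar\theta_i}+\frac{\|\hat\theta_i(0)\|^2}{\bar\theta_i^2}\right)},$$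 then any Lipschitz continuous controller $u$ (a function of $(\hat x,\hat\theta,t)$) with $u\in K_{BF}(\hat x,\hat\theta,t)$, where $$K_{BF}(\hat x,\hat\theta,t)=\left\{u\in\mathbb{R}^m:\ L_g h_\epsilon\,u+L_{\tilde f}h_\epsilon-\mu N\epsilon+\frac{\partial h_\epsilon}{\partial t}-\left\|\frac{\partial h_\epsilon}{\partial\hat x}\right\|E+\mu h_\epsilon\ge 0\right\},\qquad \tilde f=f(\hat x)+\sum_{i=1}^N\hat\theta_i\varphi_i(t),$$ guarantees the safety of $\mathcal{C}$, i.e. along the closed-loop trajectory, $h(x(t))\ge 0$ for all $t\ge 0$.
   Context: Plant: $\dot x=f(x)+g(x)u$, $y=l(x)$, with state $x\in\mathbb{R}^n$, input $u\in\mathbb{R}^m$, output $y\in\mathbb{R}^k$, where $f:\mathbb{R}^n\to\mathbb{R}^n$ and $g:\mathbb{R}^n\to\mathbb{R}^{n\times m}$ are locally Lipschitz and $l:\mathbb{R}^n\to\mathbb{R}^k$. $\|\cdot\|$ is the Euclidean norm. Observer: $\dot{\hat x}=v(\hat x,y,u)$, with $\hat x\in\mathbb{R}^n$. It is an estimation error quantified (EEQ) observer if $\|\hat x(t)-x(t)\|\le M(t)$ for all $t\ge 0$, where $M(t)=M(t,x(0),\hat x(0))\ge 0$ is a known non-negative function of time ($M$ is differentiable in $t$, so that $\partial h_\epsilon/\partial t=-L\dot M(t)$ makes sense). Reconstructed system: with $e=\hat x-x$, one has identically $\dot{\hat x}=f(\hat x)+g(\hat x)u+\Lambda$, where $\Lambda=\dot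 e+(f(x)-f(\hat x))+(g(x)-g(\hat x))u\in\mathbb{R}^n$. Along the closed-loop trajectory $\Lambda$ is a function of time and is written $\Lambda=\sum_{i=1}^N\theta_i\varphi_i(t)+\epsilon_\Lambda(t)$, with $N$ a positive integer, $\theta_i\in\mathbb{R}^n$ unknown constant vectors, $\epsilon_\Lambda(t)\in\mathbb{R}^n$ the truncation error, and scalar trigonometric basis functions (for a frequency $\omega$) $\varphi_0(t)=1$, $\varphi_{2k-1}(t)=\cos k\omega t$, $\varphi_{2k}(t)=\sin k\omega t$ for $k\ge 1$. Conventions: the gradient $\partial h_\epsilon/\partial\hat x$ is viewed as a column vector; $L_g h_\epsilon=(\partial h_\epsilon/\partial\hat x)^\top g(\hat x)$ and $L_{\tilde f}h_\epsilon=(\partial h_\epsilon/\partial\hat x)^\top\tilde f$; $\hat\theta$ collects $\hat\theta_1,\dots,\hat\theta_N$. Relative degree 1 means that $L_gh=(\partial h/\partial x)^\top g$ is nonzero, i.e. the input appears in the first derivative of $h$. Closed-loop trajectories $(x(t),\hat x(t),\hat\theta(t))$ are understood to exist for all $t\ge0$. *)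

(* Defs.v *)
(* MathComp / MathComp-Analysis, over an abstract [R : realType]. *)
From HB Require Import structures.
From mathcomp Require Export all_boot all_order all_algebra.
From mathcomp Require Export all_classical all_reals all_analysis.

Set Implicit Arguments.
Unset Strict Implicit.
Unset Printing Implicit Defensive.

Export Order.TTheory GRing.Theory Num.Theory numFieldNormedType.Exports.

Local Open Scope classical_set_scope.
Local Open Scope ring_scope.

(* The library norm [`|z|] on matrices is the max norm, hence this one. *)
Definition enorm (R : realType) (n : nat) (z : 'cV[R]_n) : R :=
  Num.sqrt (\sum_(i < n) z i 0 ^+ 2).

(* Local and global Lipschitz continuity are stated with the library's
   (max) norms: changing to Euclidean norms only changes the constants. *)
Definition locally_lipschitz (R : realType) (V W : normedModType R)
    (F : V -> W) : Prop :=
  forall z : V, exists2 A : set V, nbhs z A & [lipschitz F y | y in A].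

Definition grad (R : realType) (n : nat) (h : 'cV[R]_n -> R) (z : 'cV[R]_n) :
    'cV[R]_n :=
  \col_(i < n) 'D_(delta_mx i 0) h z.

Definition cont_differentiable (R : realType) (n : nat) (h : 'cV[R]_n -> R) :
    Prop :=
  (forall z, differentiable h z) /\ continuous (grad h).

(* The Lie derivative of [h] along the column(s) of [F], a row vector. *)
Definition lie (R : realType) (n p : nat) (h : 'cV[R]_n -> R)
    (F : 'M[R]_(n, p)) (z : 'cV[R]_n) : 'rV[R]_p :=
  (grad h z)^T *m F.

Definition relative_degree1 (R : realType) (n m : nat) (h : 'cV[R]_n -> R)
    (g : 'cV[R]_n -> 'M[R]_(n, m)) : Prop :=
  forall z, lie h (g z) z != 0.

Definition safe_set (R : realType) (n : nat) (h : 'cV[R]_n -> R) :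
    set 'cV[R]_n :=
  [set z | 0 <= h z].

(* Time derivatives for functions of time on [0, +oo): two-sided at t > 0 and
   one-sided at t = 0; values at negative times are irrelevant. *)
Definition tquot (R : realType) (V : normedModType R) (F : R -> V) (t s : R) :
    V :=
  (s - t)^-1 *: (F s - F t).

Definition has_tderiv (R : realType) (V : normedModType R) (F : R -> V)
    (t : R) (d : V) : Prop :=
  tquot F t s @[s --> within [set s | 0 <= s] t^'] --> d.

Definition tderiv (R : realType) (V : normedModType R) (F : R -> V) (t : R) :
    V :=
  lim (tquot F t s @[s --> within [set s | 0 <= s] t^']).

Definition plant_trajectory (R : realType) (n m : nat)
    (f : 'cV[R]_n -> 'cV[R]_n) (g : 'cV[R]_n -> 'M[R]_(n, m))
    (u : R -> 'cV[R]_m) (x : R -> 'cV[R]_n) : Prop :=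
  forall t : R, 0 <= t -> has_tderiv x t (f (x t) + g (x t) *m u t).

Definition observer_trajectory (R : realType) (n m k : nat)
    (v : 'cV[R]_n -> 'cV[R]_k -> 'cV[R]_m -> 'cV[R]_n)
    (y : R -> 'cV[R]_k) (u : R -> 'cV[R]_m) (xhat : R -> 'cV[R]_n) : Prop :=
  forall t : R, 0 <= t -> has_tderiv xhat t (v (xhat t) (y t) (u t)).

(* [Mt] is the time function M(., x(0), xhat(0)). *)
Definition eeq_bound (R : realType) (n : nat) (Mt : R -> R)
    (x xhat : R -> 'cV[R]_n) : Prop :=
  (forall t : R, 0 <= t -> exists d : R, has_tderiv Mt t d) /\
  (forall t : R, 0 <= t -> 0 <= Mt t /\ enorm (xhat t - x t) <= Mt t).

(* phi_0 = 1, phi_(2k-1) = cos (k omega t), phi_(2k) = sin (k omega t). *)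
Definition trig_basis (R : realType) (omega : R) (i : nat) (t : R) : R :=
  if i == 0%N then 1
  else if odd i then cos ((i.+1)./2%:R * omega * t)
  else sin (i./2%:R * omega * t).

(* A family theta_1, ..., theta_N of vectors is stored as the columns of an
   n x N matrix; column [i : 'I_N] (counted from 0) is theta_(i+1). *)
Definition trig_sum (R : realType) (n N : nat) (omega : R)
    (th : 'M[R]_(n, N)) (t : R) : 'cV[R]_n :=
  \sum_(i < N) trig_basis omega i.+1 t *: col i th.

Definition Lambda (R : realType) (n m : nat)
    (f : 'cV[R]_n -> 'cV[R]_n) (g : 'cV[R]_n -> 'M[R]_(n, m))
    (u : R -> 'cV[R]_m) (x xhat : R -> 'cV[R]_n) (t : R) : 'cV[R]_n :=
  tderiv (fun s => xhat s - x s) t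
  + (f (x t) - f (xhat t)) + (g (x t) - g (xhat t)) *m u t.

Definition h_zero (R : realType) (n : nat) (h : 'cV[R]_n -> R) (L : R)
    (Mt : R -> R) (xh : 'cV[R]_n) (t : R) : R :=
  h xh - L * Mt t.

Definition h_eps (R : realType) (n : nat) (h : 'cV[R]_n -> R) (L : R)
    (Mt : R -> R) (eps : R) (xh : 'cV[R]_n) (t : R) : R :=
  h_zero h L Mt xh t - eps.

Definition KBF (R : realType) (n m N : nat)
    (f : 'cV[R]_n -> 'cV[R]_n) (g : 'cV[R]_n -> 'M[R]_(n, m)) (omega : R)
    (he : 'cV[R]_n -> R -> R) (mu eps E : R)
    (xh : 'cV[R]_n) (th : 'M[R]_(n, N)) (t : R) : set 'cV[R]_m :=
  let het := fun z => he z t in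
  let ftilde := f xh + trig_sum omega th t in
  [set u | 0 <= (lie het (g xh) xh *m u) 0 0 + lie het ftilde xh 0 0
                - mu * N%:R * eps + tderiv (he xh) t
                - enorm (grad het xh) * E + mu * he xh t].

(* Main.v *)
Require Import Defs.
From mathcomp Require Import ring lra.
Local Open Scope classical_set_scope.
Local Open Scope ring_scope.

(** Write V for the parameter error
      V = sum_i (eps / thetabar_i^2) ||theta_i - thetahat_i||^2
    and consider W = h_eps(xhat, t) - V along the closed loop.

    Differentiating, the unknown term grad h . sum_i theta_i phi_i of the
    reconstructed system splits into its estimate, which the controller sees,
    plus grad h . sum_i phi_i (theta_i - thetahat_i).  The adaptation law is
    tuned so that this last term also appears in V' and cancels
    ([is_derive_weighted_error]).  What its leakage term - mu thetahat_i leaves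
    behind is at most mu (N eps - V) ([weighted_error_rate_le]); the membership
    of u in K_BF pays for mu N eps, and its margin ||grad h|| E absorbs
    eLambda by Cauchy-Schwarz.  The outcome is W' >= - mu W, hence
    W(t) >= W(0) exp(- mu t) ([exp_decay_lower_bound]).

    The bound on eps only gives W(0) >= - eps ([weighted_error_le]), so W may
    be negative; but then W(t) >= - eps exp(- mu t) >= - eps, and since V >= 0,
      h(xhat) - L M = h_eps + eps >= W + eps >= 0.
    Finally |h(x) - h(xhat)| <= L ||x - xhat|| <= L M turns this into
    h(x) >= 0.

    The derivatives of the trajectories at time 0 are one-sided.  They serve
    only to make W continuous from the right at 0, which is all that the mean
    value theorem on [0, t] asks for at that end; at positive times they are
    the usual derivatives. *)

Set Implicit Arguments.
Unset Strict Implicit.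
Unset Printing Implicit Defensive.

(** * Derivatives with respect to time *)

(** Makes the limit in the definition of time derivatives unique, also at
    the boundary time 0. *)
Lemma time_dnbhs_proper (R : realType) (t : R) : 0 <= t ->
  ProperFilter (within [set s | 0 <= s] t^').
Proof.
move=> t0; apply: Build_ProperFilter_ex => P.
rewrite /within /= /dnbhs /within /= => /nbhs_ballP[e /= e0 be].
have e20 : 0 < e / 2 by rewrite divr_gt0.
exists (t + e / 2); apply: be.
- rewrite /ball /= opprD addNKr normrN gtr0_norm//.
  by rewrite ltr_pdivrMr// ltr_pMr// ltr1n.
- by rewrite gt_eqF// ltrDl.
- by rewrite /= addr_ge0// ltW.
Qed.

Lemma has_tderiv_tderiv (R : realType) (V : normedModType R) (F : R -> V)
  (t : R) (d : V) : 0 <= t -> has_tderiv F t d -> tderiv F t = d.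
Proof.
move=> t0 Fd; have ? := time_dnbhs_proper t0.
exact: (cvg_lim (@norm_hausdorff _ _)).
Qed.

Lemma has_tderivB (R : realType) (V : normedModType R) (F G : R -> V)
  (t : R) (a b : V) : has_tderiv F t a -> has_tderiv G t b ->
  has_tderiv (fun s => F s - G s) t (a - b).
Proof.
rewrite /has_tderiv => Fa Gb.
have -> : tquot (fun s => F s - G s) t = fun s => tquot F t s - tquot G t s.
  by apply/funext => s; rewrite /tquot -scalerBr; congr (_ *: _);
    rewrite !opprD !opprK addrACA.
exact: cvgB.
Qed.

Lemma has_tderiv_affine (R : realType) (F : R -> R) (c t d e : R) :
  has_tderiv F t d -> has_tderiv (fun s => e - c * F s) t (- (c * d)).
Proof.
rewrite /has_tderiv => Fd.
have -> : tquot (fun s => e - c * F s) t = fun s => - (c * tquot F t s).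
  by apply/funext => s; rewrite /tquot /GRing.scale/=; ring.
by apply: cvgN; apply: cvgMl_tmp.
Qed.

(** Near a positive time, the restriction to nonnegative times is void. *)
Lemma has_tderiv_is_derive (R : realType) (V : normedModType R) (F : R -> V)
  (t : R) (d : V) : 0 < t -> has_tderiv F t d -> is_derive t 1 F d.
Proof.
move=> t0 Fd.
have Q : (fun h : R => h^-1 *: (F (h *: 1 + t) - F t)) @ 0^' --> d.
  have -> : (fun h : R => h^-1 *: (F (h *: 1 + t) - F t))
            = tquot F t \o (fun h => h + t).
    by apply/funext => h; rewrite /tquot /= addrK /GRing.scale /= mulr1.
  apply: cvg_comp Fd => P.
  rewrite /within /= /dnbhs /within /= => Pt.
  have /(_ _ Pt) : (fun h : R => h + t) @ (0 : R) --> t.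
    rewrite -[X in _ --> X]add0r; apply: cvgD; [exact: cvg_id|exact: cvg_cst].
  have : \forall h \near (0 : R), 0 <= h + t.
    near=> h; suff : - t < h by rewrite -subr_gt0 opprK => /ltW.
    by near: h; apply: lt_nbhsr; rewrite oppr_lt0.
  apply: filterS2 => h /= ht Ph h0; apply: Ph => //.
  by rewrite -subr_eq0 addrK.
by apply: DeriveDef; [apply/cvg_ex; exists d|apply: cvg_lim Q].
Unshelve. all: by end_near. Qed.

(** F s = s *: (difference quotient) + F 0, and the first summand
    vanishes in the limit. *)
Lemma has_tderiv_cvg_right (R : realType) (V : normedModType R) (F : R -> V)
  (d : V) : has_tderiv F 0 d -> F s @[s --> 0^'+] --> F 0.
Proof.
move=> Fd.
have Q : tquot F 0 s @[s --> (0:R)^'+] --> d.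
  apply: cvg_trans Fd => P.
  rewrite /nbhs /= /fmap /= /within /= /dnbhs /at_right /within /=.
  apply: (@filterS _ (nbhs (0 : R))) => s Ps s0.
  by apply: Ps; [rewrite gt_eqF | exact: ltW].
rewrite -[X in _ --> X]add0r -[X in X + _](scale0r d).
have S : s *: tquot F 0 s + F 0 @[s --> 0^'+] --> 0 *: d + F 0.
  apply: cvgD; last exact: cvg_cst.
  by apply: cvgZ => //; apply: cvg_at_right_filter; exact: cvg_id.
apply: cvg_trans S; apply: near_eq_cvg.
by near=> s; rewrite /tquot subr0 scalerA mulfV ?scale1r ?subrK// gt_eqF.
Unshelve. all: by end_near. Qed.

(** The function W(s) exp(mu s) is nondecreasing. *)
Lemma exp_decay_lower_bound (R : realType) (W dW : R -> R) (mu : R) :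
  (forall t : R, 0 < t -> is_derive t 1 W (dW t)) ->
  W s @[s --> 0^'+] --> W 0 ->
  (forall t, 0 < t -> - (mu * W t) <= dW t) ->
  forall t, 0 <= t -> W 0 * expR (- (mu * t)) <= W t.
Proof.
move=> dWE W0 dWge t; rewrite le_eqVlt => /predU1P[<-|t0].
  by rewrite mulr0 oppr0 expR0 mulr1.
pose G := (fun s => W s * expR (mu * s)) : R -> R.
have dG (s : R) : 0 < s -> is_derive s 1 G (expR (mu * s) * (dW s + mu * W s)).
  move=> s0; have := dWE _ s0 => dWs.
  have dmu : is_derive s 1 ( *%R mu) mu.
    by have := is_deriveZ mu (is_derive_id s 1); rewrite /GRing.scale/= mulr1.
  have de : is_derive s 1 (fun r => expR (mu * r)) (mu * expR (mu * s)).
    by have := @is_derive1_comp _ _ _ s _ _ (is_derive_expR _) dmu;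
      rewrite /GRing.scale/= mulrC.
  have := is_deriveM dWs de => H; apply: is_derive_eq H _.
  by rewrite /GRing.scale/=; ring.
suff : G 0 <= G t.
  rewrite /G mulr0 expR0 mulr1 => G0t.
  by rewrite expRN ler_pdivrMr ?expR_gt0.
have cG (s : R) : 0 < s -> {for s, continuous G}.
  move=> s0; apply: differentiable_continuous; apply/derivable1_diffP.
  by have [] := dG _ s0.
apply: (@ger0_derive1_le_cc _ G 0 t); rewrite ?in_itv/= ?lexx ?ltW//.
- by move=> s; rewrite in_itv/= => /andP[s0 _]; have [] := dG _ s0.
- move=> s; rewrite in_itv/= => /andP[s0 _]; rewrite derive1E.
  have [_ ->] := dG _ s0; rewrite mulr_ge0 ?expR_ge0//.
  by have := dWge _ s0; rewrite -subr_ge0 opprK.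
- apply/continuous_within_itvP => //; split.
  + by move=> s; rewrite in_itv/= => /andP[s0 _]; exact: cG.
  + apply: cvgM => //; apply: cvg_at_right_filter.
    apply: continuous_comp; [exact: mulrl_continuous|exact: continuous_expR].
  + exact/cvg_at_left_filter/cG.
Qed.

(** * Euclidean inner product and gradients *)

Definition dotv (R : realType) (n : nat) (a b : 'cV[R]_n) : R :=
  (a^T *m b) 0 0.

Lemma dotvE (R : realType) (n : nat) (a b : 'cV[R]_n) :
  dotv a b = \sum_(i < n) a i 0 * b i 0.
Proof. by rewrite /dotv mxE; apply: eq_bigr => i _; rewrite mxE. Qed.

Lemma dotvC (R : realType) (n : nat) (a b : 'cV[R]_n) : dotv a b = dotv b a.
Proof. by rewrite !dotvE; apply: eq_bigr => i _; rewrite mulrC. Qed.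

Lemma dotvDr (R : realType) (n : nat) (a b c : 'cV[R]_n) :
  dotv a (b + c) = dotv a b + dotv a c.
Proof. by rewrite /dotv mulmxDr mxE. Qed.

Lemma dotvZr (R : realType) (n : nat) (a b : 'cV[R]_n) (k : R) :
  dotv a (k *: b) = k * dotv a b.
Proof. by rewrite /dotv -scalemxAr mxE. Qed.

Lemma dotvNr (R : realType) (n : nat) (a b : 'cV[R]_n) :
  dotv a (- b) = - dotv a b.
Proof. by rewrite -scaleN1r dotvZr mulN1r. Qed.

Lemma dotv_sumr (R : realType) (n N : nat) (a : 'cV[R]_n)
  (b : 'I_N -> 'cV[R]_n) :
  dotv a (\sum_(i < N) b i) = \sum_(i < N) dotv a (b i).
Proof. by rewrite /dotv mulmx_sumr summxE. Qed.

Lemma enorm_ge0 (R : realType) (n : nat) (a : 'cV[R]_n) : 0 <= enorm a.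
Proof. exact: sqrtr_ge0. Qed.

Lemma enorm_sqr (R : realType) (n : nat) (a : 'cV[R]_n) :
  enorm a ^+ 2 = dotv a a.
Proof.
rewrite /enorm sqr_sqrtr ?dotvE; last by apply: sumr_ge0 => i _; exact: sqr_ge0.
by apply: eq_bigr => i _; rewrite expr2.
Qed.

Lemma sqr_enormB (R : realType) (n : nat) (a b : 'cV[R]_n) :
  enorm (a - b) ^+ 2 = enorm a ^+ 2 - 2 * dotv a b + enorm b ^+ 2.
Proof.
rewrite !enorm_sqr !dotvE mulr_sumr -sumrB -big_split.
by apply: eq_bigr => i _ /=; rewrite !mxE; ring.
Qed.

Lemma enormN (R : realType) (n : nat) (a : 'cV[R]_n) : enorm (- a) = enorm a.
Proof. by congr Num.sqrt; apply: eq_bigr => i _; rewrite mxE sqrrN. Qed.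

(** Cauchy-Schwarz, from the nonnegativity of the squared norm of
    ||b||^2 a - (a.b) b, which equals
    ||b||^2 (||a||^2 ||b||^2 - (a.b)^2). *)
Lemma dotv_le_enorm (R : realType) (n : nat) (a b : 'cV[R]_n) :
  dotv a b <= enorm a * enorm b.
Proof.
have [b0|b_gt0] := leP (enorm b) 0.
  have b0' : enorm b = 0 by apply/eqP; rewrite eq_le b0 enorm_ge0.
  have : dotv b b = 0 by rewrite -enorm_sqr b0' expr0n.
  rewrite dotvE => /eqP; rewrite psumr_eq0; last first.
    by move=> i _; rewrite -expr2 sqr_ge0.
  move=> /allP bi; rewrite b0' mulr0 dotvE big1// => i _.
  have := bi i (mem_index_enum _); rewrite implyTb mulf_eq0 orbb => /eqP ->.
  by rewrite mulr0.
have := sqr_ge0 (enorm (enorm b ^+ 2 *: a - dotv a b *: b)).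
rewrite sqr_enormB !enorm_sqr !dotvZr ![dotv (_ *: _) _]dotvC !dotvZr.
rewrite -!enorm_sqr (dotvC b a) => H.
have {}H : 0 <= enorm b ^+ 2 * ((enorm a * enorm b) ^+ 2 - dotv a b ^+ 2).
  by apply: le_trans H _; rewrite le_eqVlt; apply/orP; left; apply/eqP; ring.
rewrite pmulr_rge0 ?exprn_gt0// subr_ge0 in H.
apply: le_trans (ler_norm _) _.
rewrite -(ler_pXn2r (n := 2))// ?nnegrE ?mulr_ge0 ?enorm_ge0//.
by rewrite real_normK// num_real.
Qed.

Lemma is_derive_coord (R : realType) (p q : nat) (F : R -> 'M[R]_(p, q))
  (t : R) (d : 'M[R]_(p, q)) i j :
  is_derive t 1 F d -> is_derive t 1 (fun s => F s i j) (d i j).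
Proof.
move=> [dF <-]; apply: DeriveDef; first exact: ((derivable_mxP _ _ _).1 dF).
by rewrite derive_mx// mxE.
Qed.

Lemma is_derive_enorm_sqr (R : realType) (n : nat) (F : R -> 'cV[R]_n)
  (t : R) (d : 'cV[R]_n) : is_derive t 1 F d ->
  is_derive t 1 (fun s => enorm (F s) ^+ 2) (2 * dotv (F t) d).
Proof.
move=> Fd.
have -> : (fun s => enorm (F s) ^+ 2)
          = \sum_(i < n) (fun s => F s i 0) ^+ 2.
  apply/funext => s; rewrite fct_sumE enorm_sqr dotvE.
  by apply: eq_bigr => i _; rewrite -expr2.
have Fi (i : 'I_n) := is_derive_coord i 0 Fd.
apply: is_derive_eq.
rewrite dotvE mulr_sumr; apply: eq_bigr => i _.
by rewrite /GRing.scale/= expr1 mulrA.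
Qed.

(** The differential is linear, hence determined by the partial derivatives
    collected in the gradient. *)
Lemma is_derive_grad (R : realType) (n : nat) (h : 'cV[R]_n -> R)
  (F : R -> 'cV[R]_n) (t : R) (d : 'cV[R]_n) :
  differentiable h (F t) -> is_derive t 1 F d ->
  is_derive t 1 (h \o F) (dotv (grad h (F t)) d).
Proof.
move=> hd [/derivable1_diffP Fd <-].
have hF : differentiable (h \o F) t by exact: differentiable_comp.
apply: DeriveDef; first exact/derivable1_diffP.
rewrite deriveE// diff_comp//= -(deriveE (1 : R) Fd).
rewrite {1}['D_1 F t]matrix_sum_delta linear_sum dotvE.
apply: eq_bigr => i _; rewrite big_ord1 linearZ /= -deriveE// mxE.
by rewrite /GRing.scale/= mulrC.
Qed.

Lemma gradBcst (R : realType) (n : nat) (h : 'cV[R]_n -> R) (c : R) z :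
  differentiable h z -> grad (fun y => h y - c) z = grad h z.
Proof.
move=> hz; apply/matrixP => i j; rewrite !mxE.
rewrite (_ : (fun y => h y - c) = h - cst c)//.
rewrite deriveB; [by rewrite derive_cst subr0|exact: diff_derivable|].
exact: derivable_cst.
Qed.

(** * The weighted parameter error *)

Definition weighted_error (R : realType) (n N : nat) (eps : R)
    (c : 'I_N -> R) (th est : 'M[R]_(n, N)) : R :=
  \sum_(i < N) eps / c i ^+ 2 * enorm (col i th - col i est) ^+ 2.

Lemma weighted_error_ge0 (R : realType) (n N : nat) (eps : R)
    (c : 'I_N -> R) (th est : 'M[R]_(n, N)) :
  0 <= eps -> 0 <= weighted_error eps c th est.
Proof.
move=> eps0; apply: sumr_ge0 => i _.
by rewrite mulr_ge0 ?divr_ge0 ?sqr_ge0.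
Qed.

(** Each term is at most eps (1 + ||est_i|| / c_i)^2, by the triangle
    inequality.  Expanding the square yields the denominator in the condition
    on eps. *)
Lemma weighted_error_le (R : realType) (n N : nat) (eps : R)
    (c : 'I_N -> R) (th est : 'M[R]_(n, N)) :
  0 <= eps -> (forall i, 0 < c i) -> (forall i, enorm (col i th) <= c i) ->
  weighted_error eps c th est <=
  eps * (N%:R + \sum_(i < N) (2 * enorm (col i est) / c i
                              + enorm (col i est) ^+ 2 / c i ^+ 2)).
Proof.
move=> eps0 c0 thc; rewrite -[N in N%:R]card_ord -sum1_card natr_sum.
rewrite -big_split mulr_sumr /=; apply: ler_sum => i _.
rewrite -mulrA ler_wpM2l// mulrC ler_pdivrMr ?exprn_gt0//.
have -> : (1 + (2 * enorm (col i est) / c i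
           + enorm (col i est) ^+ 2 / c i ^+ 2)) * c i ^+ 2
          = (c i + enorm (col i est)) ^+ 2.
  by field; rewrite gt_eqF.
have thsq : enorm (col i th) ^+ 2 <= c i ^+ 2.
  by rewrite ler_pXn2r// ?nnegrE ?enorm_ge0// ltW.
have := dotv_le_enorm (col i th) (- col i est); rewrite dotvNr enormN => cs.
have := ler_wpM2r (enorm_ge0 (col i est)) (thc i) => cs'.
by rewrite sqr_enormB sqrrD; lra.
Qed.

Lemma weighted_error_cvg (R : realType) (n N : nat) (eps : R)
    (c : 'I_N -> R) (th : 'M[R]_(n, N)) (est : R -> 'M[R]_(n, N)) :
  (forall i, col i (est s) @[s --> 0^'+] --> col i (est 0)) ->
  weighted_error eps c th (est s) @[s --> 0^'+] -->
  weighted_error eps c th (est 0).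
Proof.
move=> estc; apply: cvg_big => [|i _]; first exact: add_continuous.
apply: cvgMl_tmp; rewrite enorm_sqr dotvE.
under eq_fun do rewrite enorm_sqr dotvE.
apply: cvg_big => [|j _]; first exact: add_continuous.
have cj : (col i th - col i (est s)) j 0 @[s --> 0^'+] -->
    (col i th - col i (est 0)) j 0.
  apply: (cvg_comp _ (fun z : 'cV[R]_n => z j 0)); last exact: coord_continuous.
  by apply: cvgB => //; exact: cvg_cst.
exact: cvgM.
Qed.

(** The gain c_i^2 / (2 eps) of the adaptation law is the inverse of
    2 eps / c_i^2, the factor by which the derivative of the weighted square
    multiplies it: the gradient enters with coefficient exactly phi_i,
    whatever the weights. *)
Lemma is_derive_weighted_error (R : realType) (n N : nat) (eps mu t : R)
    (c phi : 'I_N -> R) (th : 'M[R]_(n, N)) (est : R -> 'M[R]_(n, N))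
    (G : 'cV[R]_n) : eps != 0 -> (forall i, 0 < c i) ->
  (forall i, is_derive t 1 (fun s => col i (est s))
     (- ((c i ^+ 2 / (2 * eps) * phi i) *: G) - mu *: col i (est t))) ->
  is_derive t 1 (fun s => weighted_error eps c th (est s))
    (dotv G (\sum_(i < N) phi i *: (col i th - col i (est t)))
     + mu * \sum_(i < N) eps / c i ^+ 2 *
         (2 * dotv (col i th - col i (est t)) (col i (est t)))).
Proof.
move=> eps0 c0 dest.
have -> : (fun s => weighted_error eps c th (est s)) =
  \sum_(i < N) ((eps / c i ^+ 2)
    \*: (fun s => enorm (col i th - col i (est s)) ^+ 2)).
  by apply/funext => s; rewrite fct_sumE.
have derr i := is_derive_enorm_sqr
  (is_deriveB (is_derive_cst (col i th) t 1) (dest i)).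
apply: is_derive_eq.
rewrite dotv_sumr mulr_sumr -big_split; apply: eq_bigr => i _ /=.
rewrite sub0r opprD !opprK dotvDr !dotvZr [dotv G _]dotvC /GRing.scale/=.
by rewrite /cst; field; rewrite eps0 gt_eqF.
Qed.

(** Completing the square: 2 (p - q).q = ||p||^2 - ||p - q||^2 - ||q||^2,
    with p a true parameter and q its estimate; then ||p|| <= c_i. *)
Lemma weighted_error_rate_le (R : realType) (n N : nat) (eps : R)
    (c : 'I_N -> R) (th est : 'M[R]_(n, N)) :
  0 <= eps -> (forall i, 0 < c i) -> (forall i, enorm (col i th) <= c i) ->
  \sum_(i < N) eps / c i ^+ 2 *
         (2 * dotv (col i th - col i est) (col i est))
  <= N%:R * eps - weighted_error eps c th est.
Proof.
move=> eps0 c0 thc; have -> : N%:R * eps = \sum_(i < N) eps.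
  by rewrite sumr_const card_ord mulr_natl.
rewrite /weighted_error -sumrB.
apply: ler_sum => i _.
have thsq : enorm (col i th) ^+ 2 <= c i ^+ 2.
  by rewrite ler_pXn2r// ?nnegrE ?enorm_ge0// ltW.
rewrite [leRHS](_ : _ = eps / c i ^+ 2
    * (c i ^+ 2 - enorm (col i th - col i est) ^+ 2)); last first.
  by field; rewrite gt_eqF.
apply: ler_wpM2l; first by rewrite divr_ge0// sqr_ge0.
rewrite dotvC dotvDr dotvNr -enorm_sqr sqr_enormB (dotvC (col i est)).
have := sqr_ge0 (enorm (col i est)).
by lra.
Qed.

(** * Safety *)

Theorem theorem1 (R : realType) (n m k N : nat) (N_gt0 : (0 < N)%N)
  (* plant and observer *)
  (f : 'cV[R]_n -> 'cV[R]_n) (g : 'cV[R]_n -> 'M[R]_(n, m))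
  (l : 'cV[R]_n -> 'cV[R]_k)
  (v : 'cV[R]_n -> 'cV[R]_k -> 'cV[R]_m -> 'cV[R]_n)
  (f_lip : locally_lipschitz f) (g_lip : locally_lipschitz g)
  (* constraint function *)
  (h : 'cV[R]_n -> R) (h_C1 : cont_differentiable h)
  (h_reldeg : relative_degree1 h g)
  (L : R) (L_gt0 : 0 < L)
  (h_lip : forall z zh : 'cV[R]_n, `|h z - h zh| <= L * enorm (z - zh))
  (* closed-loop signals *)
  (x xhat : R -> 'cV[R]_n) (thetahat : R -> 'M[R]_(n, N))
  (u : R -> 'cV[R]_m)
  (x_traj : plant_trajectory f g u x)
  (xhat_traj : observer_trajectory v (fun t => l (x t)) u xhat)
  (* error bound of the EEQ observer *)
  (M : R -> 'cV[R]_n -> 'cV[R]_n -> R)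
  (M_eeq : eeq_bound (fun t => M t (x 0) (xhat 0)) x xhat)
  (* parametrization of the reconstructed system *)
  (omega : R) (theta : 'M[R]_(n, N)) (eLambda : R -> 'cV[R]_n)
  (Lambda_eq : forall t : R, 0 <= t ->
     Lambda f g u x xhat t = trig_sum omega theta t + eLambda t)
  (E : R) (E_gt0 : 0 < E)
  (eLambda_le : forall t : R, 0 <= t -> enorm (eLambda t) <= E)
  (thetabar : 'I_N -> R) (thetabar_gt0 : forall i, 0 < thetabar i)
  (theta_le : forall i, enorm (col i theta) <= thetabar i)
  (* barrier functions and parameter estimates *)
  (mu eps : R) (mu_gt0 : 0 < mu) (eps_gt0 : 0 < eps)
  (h0 he : 'cV[R]_n -> R -> R)
  (h0E : h0 = h_zero h L (fun t => M t (x 0) (xhat 0)))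
  (heE : he = h_eps h L (fun t => M t (x 0) (xhat 0)) eps)
  (thetahat_traj : forall t : R, 0 <= t -> forall i : 'I_N,
     has_tderiv (fun s => col i (thetahat s)) t
       (- ((thetabar i ^+ 2 / (2 * eps) * trig_basis omega i.+1 t)
           *: grad (fun z => he z t) (xhat t))
        - mu *: col i (thetahat t)))
  (eps_le : eps <= h0 (xhat 0) 0 /
     (N%:R + \sum_(i < N) (2 * enorm (col i (thetahat 0)) / thetabar i
                 + enorm (col i (thetahat 0)) ^+ 2 / thetabar i ^+ 2)))
  (* controller *)
  (kappa : 'cV[R]_n * 'M[R]_(n, N) * R -> 'cV[R]_m)
  (kappa_lip : [lipschitz kappa z | z in [set z | 0 <= z.2]])
  (u_fb : forall t : R, 0 <= t -> u t = kappa (xhat t, thetahat t, t))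
  (u_KBF : forall t : R, 0 <= t ->
     KBF f g omega he mu eps E (xhat t) (thetahat t) t (u t)) :
  forall t : R, 0 <= t -> safe_set h (x t).
Proof.
subst h0 he.
set Mt := (fun t => M t (x 0) (xhat 0)) in M_eeq thetahat_traj eps_le u_KBF *.
case: M_eeq => Mder Mbd; have hdiff := h_C1.1.
have gradE z t : grad (h_eps h L Mt eps ^~ t) z = grad h z.
  rewrite (_ : h_eps h L Mt eps ^~ t = fun y => h y - (L * Mt t + eps)).
    exact: gradBcst.
  by apply/funext => y; rewrite /h_eps /h_zero opprD addrA.
pose phi t (i : 'I_N) := trig_basis omega i.+1 t.
pose xh' t := v (xhat t) (l (x t)) (u t).
pose M' t := tderiv Mt t.
have dM t : 0 <= t -> has_tderiv Mt t (M' t).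
  move=> t0; have [d dd] := Mder t t0.
  by rewrite /M' (has_tderiv_tderiv t0 dd).
have xh'E t : 0 <= t -> xh' t = f (xhat t) + g (xhat t) *m u t
    + trig_sum omega theta t + eLambda t.
  move=> t0; rewrite -addrA -(Lambda_eq t t0) /Lambda.
  rewrite (has_tderiv_tderiv t0 (has_tderivB (xhat_traj t t0) (x_traj t t0))).
  rewrite mulmxBl -/(xh' t).
  move: (f _) (f _) (_ *m _) (_ *m _) (xh' t) => A B C D X.
  by apply/matrixP => i j; rewrite !mxE; ring.
pose err t := weighted_error eps thetabar theta (thetahat t).
pose W t := h_eps h L Mt eps (xhat t) t - err t.
pose G t := grad h (xhat t).
pose derr t :=
  dotv (G t) (\sum_(i < N) phi t i *: (col i theta - col i (thetahat t)))
  + mu * \sum_(i < N) eps / thetabar i ^+ 2 *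
         (2 * dotv (col i theta - col i (thetahat t)) (col i (thetahat t))).
pose dW t := dotv (G t) (xh' t) - L * M' t - derr t.
have dWE (t : R) : 0 < t -> is_derive t 1 W (dW t).
  move=> t0; have t0' := ltW t0.
  have dh := is_derive_grad (hdiff _)
    (has_tderiv_is_derive t0 (xhat_traj t t0')).
  have dMt := has_tderiv_is_derive t0 (dM t t0').
  have dE : is_derive t 1 err (derr t).
    apply: is_derive_weighted_error => [||i]; [by rewrite gt_eqF|by []|].
    by have := has_tderiv_is_derive t0 (thetahat_traj t t0' i); rewrite gradE.
  have -> : W = (h \o xhat) - L \*: Mt - cst eps - err by apply/funext.
  apply: is_derive_eq.
  by rewrite /dW subr0.
have Wcont : W s @[s --> 0^'+] --> W 0.
  apply: cvgB; last first.
    apply: weighted_error_cvg => i.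
    exact: (has_tderiv_cvg_right (thetahat_traj 0 (lexx 0) i)).
  apply: cvgB; last exact: cvg_cst.
  apply: cvgB.
    apply: (cvg_comp _ h (has_tderiv_cvg_right (xhat_traj 0 (lexx 0)))).
    exact: (differentiable_continuous (hdiff (xhat 0))).
  apply: cvgMl_tmp; exact: (has_tderiv_cvg_right (dM 0 (lexx 0))).
have dWge (t : R) : 0 < t -> - (mu * W t) <= dW t.
  move=> /ltW t0; have := u_KBF t t0.
  rewrite /KBF /= /lie !gradE.
  have -> : tderiv (h_eps h L Mt eps (xhat t)) t = - (L * M' t).
    apply: has_tderiv_tderiv => //.
    rewrite (_ : h_eps _ _ _ _ _ = fun s => (h (xhat t) - eps) - L * Mt s).
      exact: has_tderiv_affine (dM t t0).
    by apply/funext => s; rewrite /h_eps /h_zero addrAC.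
  rewrite -mulmxA -!/(dotv _ _) -/(G t).
  rewrite /dW xh'E//.
  have -> : trig_sum omega theta t = trig_sum omega (thetahat t) t
     + \sum_(i < N) phi t i *: (col i theta - col i (thetahat t)).
    rewrite /trig_sum -big_split; apply: eq_bigr => i _ /=.
    by rewrite -scalerDr addrC subrK.
  rewrite /derr; set S := \sum_(i < N) _ *: _; set Q := \sum_(i < N) _ / _ * _.
  rewrite !dotvDr => barrier.
  have rate : Q <= N%:R * eps - err t.
    exact: weighted_error_rate_le (ltW eps_gt0) thetabar_gt0 theta_le.
  have muQ := ler_wpM2l (ltW mu_gt0) rate.
  have cs := dotv_le_enorm (G t) (- eLambda t).
  rewrite dotvNr enormN in cs.
  have csE := ler_wpM2l (enorm_ge0 (G t)) (eLambda_le t t0).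
  by rewrite /W; nra.
have W0 : - eps <= W 0.
  have := weighted_error_le (thetahat 0) (ltW eps_gt0) thetabar_gt0 theta_le.
  rewrite -/(err 0) => err0; move: eps_le; rewrite ler_pdivlMr; last first.
    rewrite ltr_pwDl ?ltr0n//; apply: sumr_ge0 => i _.
    by rewrite addr_ge0 ?divr_ge0 ?mulr_ge0 ?enorm_ge0
               ?exprn_ge0 ?enorm_ge0// ltW.
  move=> /(le_trans err0); rewrite /W /h_eps; lra.
move=> t t0; rewrite /safe_set /=.
have Wt := exp_decay_lower_bound dWE Wcont dWge t0.
have [_ exM] := Mbd t t0.
have err_ge0 : 0 <= err t by exact: weighted_error_ge0 (ltW eps_gt0).
have e1 : expR (- (mu * t)) <= 1 by rewrite expR_le1 oppr_le0 mulr_ge0// ltW.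
have : - eps <= W t.
  apply: le_trans Wt.
  have := expR_ge0 (- (mu * t)); nra.
have LM : L * enorm (xhat t - x t) <= L * Mt t by rewrite ler_pM2l.
have := le_trans (ler_norm _) (le_trans (h_lip (xhat t) (x t)) LM).
rewrite /W /h_eps /h_zero; lra.
Qed.
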